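(* Let $k\ge 3$ be an odd integer. Then for all integers $n\ge 1$, $$T(2n,k)=2\sum_{i=1}^{n}\binom{2n}{2i-1}\frac{B_{2i}}{2i}\left(2^{2i}-1\right)k^{2i-1}\,T(2n-2i+1,k),$$ and $$\left(1-2^{2n}\right)\left(1-k^{2n-1}\right)\frac{B_{2n}}{2n}=\frac{T(2n-1,k)}{2}+\sum_{i=1}^{n-1}\binom{2n-1}{2i-1}\frac{B_{2i}}{2i}\,k^{2i-1}\left(1-2^{2i}\right)T(2n-2i,k).$$
   Context: $B_n$ is the $n$-th Bernoulli number, defined by $\frac{t}{e^t-1}=\sum_{n\ge0}B_n\frac{t^n}{n!}$. For $s\in\mathbb{C}$ and an integer $k\ge2$, $T(s,k):=\sum_{1\le h\le k-1}(-1)^hh^s$. *)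

(* Defs.v *)
From HB Require Import structures.
From mathcomp Require Import all_boot all_order all_algebra.

Set Implicit Arguments.
Unset Strict Implicit.
Unset Printing Implicit Defensive.

Import Order.TTheory GRing.Theory Num.Theory.
Local Open Scope ring_scope.

(* A formal power series sum_n f_n t^n over Q is its sequence f of
   coefficients. *)
Definition fps := nat -> rat.

Definition fps_mul (f g : fps) : fps :=
  fun n => \sum_(j < n.+1) f j * g (n - j)%N.

Fixpoint fps_inv_seq (f : fps) (n : nat) : seq rat :=
  if n is m.+1 then
    let s := fps_inv_seq f m in
    rcons s ((f 0)^-1 * ((m == 0)%:R - \sum_(j < m) s`_j * f (m - j)%N))
  else [::].

(* The multiplicative inverse 1/f, meaningful when f 0 != 0; see fps_mulVf. *)
Definition fps_inv (f : fps) : fps := fun n => (fps_inv_seq f n.+1)`_n.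

(* (e^t - 1) / t *)
Definition expm1_divX : fps := fun n => (n.+1)`!%:R^-1.

(* B_n = n! [t^n] t / (e^t - 1); in particular B_1 = -1/2. *)
Definition bernoulli (n : nat) : rat := n`!%:R * fps_inv expm1_divX n.

(* h^s for complex s in general; only natural exponents are covered here. *)
Definition T (s k : nat) : rat :=
  \sum_(1 <= h < k) (-1) ^+ h * h%:R ^+ s.

Lemma size_fps_inv_seq f n : size (fps_inv_seq f n) = n.
Proof. by elim: n => //= n IHn; rewrite size_rcons IHn. Qed.

Lemma nth_fps_inv_seq f n j : (j < n)%N -> (fps_inv_seq f n)`_j = fps_inv f j.
Proof.
elim: n => // n IHn; rewrite ltnS leq_eqVlt => /orP[/eqP->//|ltjn].
by rewrite /= nth_rcons size_fps_inv_seq ltjn IHn.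
Qed.

Lemma fps_mulVf (f : fps) : f 0 != 0 ->
  forall n, fps_mul (fps_inv f) f n = (n == 0)%:R.
Proof.
move=> f0 n; rewrite /fps_mul big_ord_recr /= subnn.
rewrite {2}/fps_inv /= nth_rcons size_fps_inv_seq ltnn eqxx.
rewrite mulrC mulVKf //.
under [X in _ - X]eq_bigr => j _ do rewrite nth_fps_inv_seq //.
by rewrite addrC subrK.
Qed.

(* (sum_n B_n t^n / n!) * (e^t - 1) = t *)
Lemma bernoulli_egf n :
  fps_mul (fun j => bernoulli j / j`!%:R)
          (fun j => j`!%:R^-1 - (j == 0)%:R) n = (n == 1)%:R.
Proof.
have bE j : bernoulli j / j`!%:R = fps_inv expm1_divX j.
  by rewrite /bernoulli mulrC mulKf // pnatr_eq0 -lt0n fact_gt0.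
rewrite /fps_mul; under eq_bigr => j _ do rewrite bE.
case: n => [|n]; first by rewrite big_ord1 subnn invr1 subrr mulr0.
rewrite big_ord_recr /= subnn invr1 subrr mulr0 addr0 eqSS.
rewrite -(@fps_mulVf expm1_divX) ?invr1 ?oner_eq0 //.
by apply: eq_bigr => j _; rewrite subSn ?leq_ord //= subr0.
Qed.

Lemma bernoulli_small :
  (bernoulli 0, bernoulli 1, bernoulli 2, bernoulli 3, bernoulli 4) =
  (1, - (1 / 2), 1 / 6, 0, - (1 / 30)).
Proof.
rewrite /bernoulli /fps_inv /expm1_divX /=.
by rewrite !big_ord_recr !big_ord0 /=; congr (_, _, _, _, _); apply/eqP.
Qed.

(* Main.v *)
Require Import Defs.
From mathcomp Require Import all_boot all_order all_algebra.
From mathcomp Require Import ring lra zify.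

Set Implicit Arguments.
Unset Strict Implicit.
Unset Printing Implicit Defensive.

Import Order.TTheory GRing.Theory Num.Theory.
Local Open Scope ring_scope.

(** Write g(t) = 2 / (e^t + 1) = sum_j E_j t^j / j!.  For odd k the alternating
geometric sum is
  sum_(h < k) (-1)^h e^(h t) = (1 + e^(k t)) / (1 + e^t),
so multiplying it by g(k t) gives back g(t).  Comparing the coefficients of
t^s expresses E_s as a binomial convolution of the k^j E_j with the alternating
power sums.  Moreover E_j = 2 (1 - 2^(j+1)) B_(j+1) / (j+1), and E_j vanishes
for even j > 0 because g(t) + g(-t) = 2.  The cases s = 2n and s = 2n - 1 are
the two identities.

The proof replaces generating functions by umbral calculus: a sequence u is
represented by the linear functional on polynomials sending X^j to u_j.
Multiplying the exponential generating function of u by e^(b t) and rescaling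
t by a amounts to substituting aX + b before applying the functional, so each
generating function identity becomes a statement about affine substitutions,
valid for all polynomials.  The Bernoulli functional satisfies
bern (p(X+1)) - bern p = p'(0), and the functional of the E_j satisfies
eul (p(X+1)) + eul p = 2 p(0).  Dividing by e^t - 1 or by e^t + 1 becomes a
uniqueness principle: a linear functional is determined by its values on the
p(X+1) - p(X), and also by its values on the p(X+1) + p(X) (eq_shift_diff,
eq_shift_sum).  Duplication for B, reflection and multiplication for E are
all obtained by checking that both sides have the same shift equation. *)

(** * Linear functionals and affine substitutions *)

Section Functionals.

Variable F : numFieldType.
Implicit Types (p : {poly F}) (D : {poly F} -> F) (a b c d : F) (u : nat -> F).

Lemma scalar_sum D (sD : scalar D) n (c : 'I_n -> F) (q : 'I_n -> {poly F}) :
  D (\sum_i c i *: q i) = \sum_i c i * D (q i).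
Proof.
have D0 : D 0 = 0 by have := sD (-1) 0 0; rewrite scaler0 addr0 mulN1r addNr.
apply: (big_rec2 (fun x y => D x = y)) => // i y1 y2 _ <-; exact: sD.
Qed.

Lemma eq_scalar D1 D2 : scalar D1 -> scalar D2 ->
  (forall n, D1 'X^n = D2 'X^n) -> D1 =1 D2.
Proof.
move=> sD1 sD2 eqD p; rewrite -[p]coefK poly_def !scalar_sum //.
by apply: eq_bigr => i _; rewrite eqD.
Qed.

Definition umbra u p : F := \sum_(i < size p) p`_i * u i.

Lemma umbra_widen u p n : (size p <= n)%N ->
  umbra u p = \sum_(i < n) p`_i * u i.
Proof.
move=> le_pn; rewrite /umbra (big_ord_widen _ (fun i => p`_i * u i) le_pn).
rewrite big_mkcond; apply: eq_bigr => i _.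
by case: ltnP => // le_pi; rewrite nth_default ?mul0r.
Qed.

Lemma umbra_scalar u : scalar (umbra u).
Proof.
move=> a p q; set n := maxn (size p) (size q).
have [pn qn] : (size p <= n)%N /\ (size q <= n)%N.
  by rewrite leq_maxl leq_maxr.
rewrite (umbra_widen _ pn) (umbra_widen _ qn) (@umbra_widen _ _ n).
  rewrite mulr_sumr -big_split; apply: eq_bigr => i _.
  by rewrite coefD coefZ mulrDl mulrA.
by rewrite (leq_trans (size_polyD _ _)) // geq_max qn (leq_trans (size_scale_leq _ _)).
Qed.

Lemma umbraXn u n : umbra u 'X^n = u n.
Proof.
rewrite /umbra size_polyXn big_ord_recr big1 /= ?coefXn ?eqxx ?add0r ?mul1r //.
by move=> i _; rewrite coefXn ltn_eqF ?mul0r.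
Qed.

Definition affine_subst a b p : {poly F} := p \Po (a *: 'X + b%:P).

Lemma affine_substP a b c p q :
  affine_subst a b (c *: p + q) = c *: affine_subst a b p + affine_subst a b q.
Proof. by rewrite /affine_subst comp_polyD comp_polyZ. Qed.

Lemma affine_substA a b c d p :
  affine_subst c d (affine_subst a b p) = affine_subst (a * c) (a * d + b) p.
Proof.
rewrite /affine_subst -comp_polyA comp_polyD comp_polyZ comp_polyX comp_polyC.
by rewrite scalerDr scalerA polyCD polyCM mul_polyC addrA.
Qed.

Lemma affine_subst_horner0 a b p : (affine_subst a b p).[0] = p.[b].
Proof. by rewrite /affine_subst horner_comp !hornerE. Qed.

Lemma deriv_affine_subst a b p :
  (affine_subst a b p)^`() = a *: affine_subst a b p^`().
Proof.
rewrite /affine_subst deriv_comp derivD derivZ derivX derivC addr0.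
by rewrite -mul_polyC mulr1 mulrC mul_polyC.
Qed.

Lemma affine_substXn a b n : affine_subst a b 'X^n =
  \sum_(j < n.+1) ('C(n, j)%:R * a ^+ j * b ^+ (n - j)) *: 'X^j.
Proof.
rewrite /affine_subst comp_Xn_poly addrC exprDn; apply: eq_bigr => j _.
rewrite -polyC_exp exprZn -scaler_nat mul_polyC !scalerA; congr (_ *: _); ring.
Qed.

Lemma umbra_affineXn u a b n : umbra u (affine_subst a b 'X^n) =
  \sum_(j < n.+1) 'C(n, j)%:R * a ^+ j * b ^+ (n - j) * u j.
Proof.
rewrite affine_substXn (scalar_sum (umbra_scalar u)).
by apply: eq_bigr => j _; rewrite umbraXn.
Qed.

Lemma scalar_shiftXn D (sD : scalar D) n : D (affine_subst 1 1 'X^n) =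
  D 'X^n + \sum_(j < n) 'C(n, j)%:R * D 'X^j.
Proof.
rewrite affine_substXn (scalar_sum sD) big_ord_recr /= binn !expr1n !mul1r.
by rewrite addrC; congr (_ + _); apply: eq_bigr => j _; rewrite !expr1n !mulr1.
Qed.

(** The value at X^n is recovered by induction on n: X^n is half of
p(X+1) + p(X) for p = X^n, up to terms of lower degree. *)
Lemma eq_shift_sum D1 D2 : scalar D1 -> scalar D2 ->
  (forall p, D1 (affine_subst 1 1 p) + D1 p = D2 (affine_subst 1 1 p) + D2 p) ->
  D1 =1 D2.
Proof.
move=> sD1 sD2 eqD; apply: eq_scalar => //; elim/ltn_ind => n IHn.
have := eqD 'X^n; rewrite !scalar_shiftXn //.
rewrite (eq_bigr (fun j : 'I_n => 'C(n, j)%:R * D2 'X^j)) => [|j _]; last by rewrite IHn.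
rewrite ![_ + _ + D1 _]addrAC ![_ + _ + D2 _]addrAC => /addIr.
rewrite -!mulr2n -(mulr_natl (D1 _)) -(mulr_natl (D2 _)).
by apply: mulfI; rewrite pnatr_eq0.
Qed.

(** Here the value at X^n is recovered from p = X^(n+1), because
p(X+1) - p(X) is (n+1) X^n up to terms of lower degree. *)
Lemma eq_shift_diff D1 D2 : scalar D1 -> scalar D2 ->
  (forall p, D1 (affine_subst 1 1 p) - D1 p = D2 (affine_subst 1 1 p) - D2 p) ->
  D1 =1 D2.
Proof.
move=> sD1 sD2 eqD; apply: eq_scalar => //; elim/ltn_ind => n IHn.
have := eqD 'X^(n.+1); rewrite !scalar_shiftXn // !big_ord_recr /=.
rewrite (eq_bigr (fun j : 'I_n => 'C(n.+1, j)%:R * D2 'X^j)) => [|j _];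
  last by rewrite IHn.
rewrite [D1 _ + _]addrC [D2 _ + _]addrC !addrK => /addrI; apply: mulfI.
by rewrite binSn pnatr_eq0.
Qed.

End Functionals.

(** * The Bernoulli functional *)

Definition bern : {poly rat} -> rat := umbra bernoulli.

Lemma bern_scalar : scalar bern.
Proof. exact: umbra_scalar. Qed.

(** This is (e^t - 1) * sum_n B_n t^n / n! = t, read on the coefficients of
t^n / n!. *)
Lemma bern_shift p : bern (affine_subst 1 1 p) - bern p = p^`().[0].
Proof.
suff E : (fun p => bern (affine_subst 1 1 p)) =1 (fun p => bern p + p^`().[0]).
  by rewrite E addrC addKr.
apply: eq_scalar => [c q r|c q r|n].
- by rewrite affine_substP bern_scalar.
- rewrite bern_scalar derivD derivZ hornerD hornerZ; ring.
rewrite /bern umbra_affineXn umbraXn derivXn hornerMn hornerXn.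
(* The derivative of X^n at 0 is n! [t^n] t. *)
have -> : (0 ^+ n.-1 *+ n : rat) = n`!%:R * (n == 1)%:R.
  case: n => [|[|n]]; rewrite ?mulr0 ?mulr0n ?mulr1n ?expr0 ?mulr1 //.
  by rewrite exprS mul0r mul0rn.
rewrite -bernoulli_egf mulr_sumr !big_ord_recr /= subnn subrr !mulr0 addr0.
rewrite binn !expr1n !mul1r addrC; congr (_ + _); apply: eq_bigr => j _.
rewrite subn_eq0 leqNgt ltn_ord subr0 !expr1n !mulr1.
rewrite -(bin_fact (ltnW (ltn_ord j))) !natrM.
have fact_neq0 m : m`!%:R != 0 :> rat by rewrite pnatr_eq0 -lt0n fact_gt0.
have := fact_neq0 j; have := fact_neq0 (n - j)%N => ? ?; field; exact/andP.
Qed.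

(** In terms of b(t) = t / (e^t - 1) this is b(2t) (1 + e^t) = 2 b(t).  The
shift of the left-hand side telescopes to bern (p(2X+2)) - bern (p(2X)), which
the shift equation computes for the polynomial p(2X). *)
Lemma bern_duplication p :
  bern (affine_subst 2 0 p) + bern (affine_subst 2 1 p) = 2 * bern p.
Proof.
suff E : (fun p => (bern (affine_subst 2 0 p) + bern (affine_subst 2 1 p)) / 2) =1 bern.
  by have := E p; lra.
apply: eq_shift_diff => [c q r||q].
- by rewrite !affine_substP !bern_scalar; field.
- exact: bern_scalar.
have := bern_shift (affine_subst 2 0 q).
rewrite deriv_affine_subst hornerZ affine_subst_horner0 !affine_substA.
rewrite ?(mulr0, mulr1, mul1r, addr0, add0r).
have -> : 1 + 1 = 2 :> rat by [].
have := bern_shift q; lra.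
Qed.

(** * The functional of 2 / (e^t + 1) *)

(** The value at 0 of the n-th Euler polynomial, that is the coefficient of
t^n / n! in 2 / (e^t + 1). *)
Definition euler0 n : rat :=
  2 * (1 - 2 ^+ n.+1) * (bernoulli n.+1 / n.+1%:R).

Definition eul : {poly rat} -> rat := umbra euler0.

Lemma eul_scalar : scalar eul.
Proof. exact: umbra_scalar. Qed.

(** This encodes t g(t) = 2 (b(t) - b(2t)) with g(t) = 2 / (e^t + 1) and
b(t) = t / (e^t - 1): multiplying by t amounts to differentiating before
applying the functional. *)
Lemma eul_deriv p : eul p^`() = 2 * (bern p - bern (affine_subst 2 0 p)).
Proof.
move: p; apply: eq_scalar => [c q r|c q r|n].
- by rewrite derivD derivZ eul_scalar.
- rewrite !affine_substP !bern_scalar; ring.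
rewrite /bern umbra_affineXn umbraXn derivXn big_ord_recr /= binn subnn expr0.
rewrite big1 => [|j _]; last first.
  by rewrite expr0n subn_eq0 leqNgt ltn_ord !(mulr0, mul0r).
have eul0 : eul 0 = 0 by rewrite /eul /umbra size_poly0 big_ord0.
case: n => [|n] /=.
  by rewrite eul0; ring.
rewrite -scaler_nat -[_ *: _]addr0 eul_scalar eul0 /eul umbraXn /euler0.
by field; rewrite nat1r pnatr_eq0.
Qed.

Lemma antiderivative p : exists P : {poly rat}, P^`() = p.
Proof.
exists (\sum_(i < size p) (p`_i / i.+1%:R) *: 'X^(i.+1)).
rewrite -[RHS]coefK poly_def raddf_sum; apply: eq_bigr => i _ /=.
by rewrite derivZ derivXn -scaler_nat scalerA divfK // pnatr_eq0.
Qed.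

(** For an antiderivative P of p, eul_deriv reduces both terms to values of bern
at affine substitutions of P; the shift equations for P and P(2X) and the
duplication formula then evaluate them. *)
Lemma eul_shift p : eul (affine_subst 1 1 p) + eul p = 2 * p.[0].
Proof.
have [P <-] := antiderivative p.
have := deriv_affine_subst 1 1 P; rewrite scale1r => <-.
have := bern_shift (affine_subst 2 0 P).
rewrite !eul_deriv !affine_substA deriv_affine_subst hornerZ affine_subst_horner0.
rewrite ?(mulr0, mulr1, mul1r, addr0, add0r).
have := bern_shift P; have := bern_duplication P; lra.
Qed.

(** g(t) + g(-t) = 2 for g(t) = 2 / (e^t + 1).  The functional sending p to
2 p(0) - eul (p(-X)) has the shift equation of eul, as eul_shift applied to
p(1-X) shows. *)
Lemma eul_reflection p : eul p + eul (affine_subst (-1) 0 p) = 2 * p.[0].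
Proof.
suff E : eul =1 (fun p => 2 * p.[0] - eul (affine_subst (-1) 0 p)).
  by rewrite {1}E subrK.
apply: eq_shift_sum => [|c q r|q]; first exact: eul_scalar.
- rewrite affine_substP eul_scalar hornerD hornerZ; ring.
have := eul_shift (affine_subst (-1) 1 q).
rewrite !affine_subst_horner0 !affine_substA.
rewrite ?(mulr1, mul1r, mulN1r, mulr0, addr0, add0r, addNr, subrr).
have := eul_shift q; lra.
Qed.

Lemma euler0_0 : euler0 0 = 1.
Proof.
have := eul_shift 'X^0; rewrite /eul umbra_affineXn umbraXn expr0 hornerC.
by rewrite big_ord1 bin0 !expr0; lra.
Qed.

Lemma euler0_even n : (0 < n)%N -> euler0 (2 * n) = 0.
Proof.
move=> n_gt0; have := eul_reflection 'X^(2 * n).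
rewrite /eul umbra_affineXn umbraXn big_ord_recr /= binn subnn expr0.
rewrite big1 => [|j _]; last first.
  by rewrite expr0n subn_eq0 leqNgt ltn_ord !(mulr0, mul0r).
rewrite exprM sqrrN !expr1n hornerXn expr0n muln_eq0 /= eqn0Ngt n_gt0 /=; lra.
Qed.

(** The identity g(k t) sum_(h < k) (-1)^h e^(h t) = g(t) for
g(t) = 2 / (e^t + 1).  The shift X -> X + 1 raises h by 1, so with the
alternating signs the shift equation of the left-hand side telescopes.  As k is
odd, the two end terms add up, to eul (p(kX+k)) + eul (p(kX)), which is 2 p(0)
by the shift equation of eul for p(kX). *)
Lemma eul_multiplication k p : odd k ->
  \sum_(h < k) (-1) ^+ h * eul (affine_subst k%:R h%:R p) = eul p.
Proof.
move=> odd_k; move: p; apply: eq_shift_sum => [c q r||q].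
- rewrite mulr_sumr -big_split; apply: eq_bigr => h _ /=.
  by rewrite affine_substP eul_scalar; ring.
- exact: eul_scalar.
rewrite -big_split /=.
(* f h is minus the h-th term of the sum for q; its increments are the summands. *)
pose f h := - (-1) ^+ h * eul (affine_subst k%:R h%:R q).
rewrite (eq_bigr (fun h : 'I_k => f h.+1 - f h)) => [|h _]; last first.
  rewrite /f affine_substA !mul1r exprS -natr1; ring.
rewrite -(big_mkord xpredT (fun h => f h.+1 - f h)) telescope_sumr // /f.
have := eul_shift (affine_subst k%:R 0 q).
rewrite affine_substA affine_subst_horner0 -signr_odd odd_k mulr1 addr0.
have := eul_shift q; lra.
Qed.

(** * The convolution identity *)

(** The power sums T extended by the index h = 0.  This changes only exponent 0,
where the value becomes 1 instead of 0 for odd k; this is the convention for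
which the generating function is the full geometric sum. *)
Definition altsum m k : rat := \sum_(h < k) (-1) ^+ h * h%:R ^+ m.

Lemma altsum0 k : odd k -> altsum 0 k = 1.
Proof.
move=> odd_k; rewrite /altsum -[k]odd_double_half odd_k add1n.
elim: k./2 => [|n IHn]; first by rewrite big_ord1.
rewrite doubleS 2!big_ord_recr /= IHn !expr0 !exprS -signr_odd odd_double expr0.
by ring.
Qed.

Lemma altsumT m k : (0 < m)%N -> (0 < k)%N -> altsum m k = T m k.
Proof.
move=> m_gt0 k_gt0; rewrite /altsum /T.
rewrite -(big_mkord xpredT (fun h => (-1) ^+ h * h%:R ^+ m)) big_ltn //.
by rewrite expr0n eqn0Ngt m_gt0 mulr0 add0r.
Qed.

(** The multiplication formula at X^s, expanded by the binomial theorem. *)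
Lemma euler0_altsum k s : odd k ->
  \sum_(j < s.+1) 'C(s, j)%:R * k%:R ^+ j * euler0 j * altsum (s - j) k =
  euler0 s.
Proof.
move=> odd_k; have := eul_multiplication 'X^s odd_k.
rewrite {2}/eul umbraXn => <-.
under [RHS]eq_bigr => h _ do rewrite /eul umbra_affineXn mulr_sumr.
rewrite exchange_big; apply: eq_bigr => j _ /=.
by rewrite mulr_sumr; apply: eq_bigr => h _; ring.
Qed.

Lemma sum_skip_even (f : nat -> rat) n : (0 < n)%N ->
  (forall i, (0 < i)%N -> f (2 * i)%N = 0) ->
  \sum_(j < 2 * n) f j = f 0 + \sum_(1 <= i < n.+1) f (2 * i - 1)%N.
Proof.
move=> + f_even; elim: n => // -[_ _|n /(_ isT) IHn _].
  by rewrite !big_ord_recr big_ord0 big_nat1 /= add0r.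
rewrite mulnS add2n 2!big_ord_recr /= IHn f_even // addr0.
rewrite [in RHS]big_nat_recr //= addrA; congr (_ + f _); lia.
Qed.

Theorem theorem4 (k : nat) (hk3 : (3 <= k)%N) (hkodd : odd k)
    (n : nat) (hn : (1 <= n)%N) :
  T (2 * n) k =
    2 * \sum_(1 <= i < n.+1)
          'C(2 * n, 2 * i - 1)%:R * (bernoulli (2 * i) / (2 * i)%:R)
          * (2 ^+ (2 * i) - 1) * k%:R ^+ (2 * i - 1)
          * T (2 * n - 2 * i + 1) k
  /\
  (1 - 2 ^+ (2 * n)) * (1 - k%:R ^+ (2 * n - 1))
    * (bernoulli (2 * n) / (2 * n)%:R) =
    T (2 * n - 1) k / 2
    + \sum_(1 <= i < n)
        'C(2 * n - 1, 2 * i - 1)%:R * (bernoulli (2 * i) / (2 * i)%:R)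
        * k%:R ^+ (2 * i - 1) * (1 - 2 ^+ (2 * i))
        * T (2 * n - 2 * i) k.
Proof.
have k_gt0 : (0 < k)%N by apply: leq_trans hk3.
have euler0_odd i : (0 < i)%N ->
    euler0 (2 * i - 1) = 2 * (1 - 2 ^+ (2 * i)) * (bernoulli (2 * i) / (2 * i)%:R).
  by move=> i_gt0; rewrite /euler0 subn1 prednK // muln_gt0.
pose f s j := 'C(s, j)%:R * k%:R ^+ j * euler0 j * altsum (s - j) k.
have f_even s i : (0 < i)%N -> f s (2 * i)%N = 0.
  by move=> i_gt0; rewrite /f euler0_even // mulr0 mul0r.
have f0 s : (0 < s)%N -> f s 0 = T s k.
  by move=> s_gt0; rewrite /f bin0 expr0 euler0_0 subn0 altsumT // !mul1r.
split.
- have := euler0_altsum (2 * n) hkodd; rewrite euler0_even // big_ord_recr /=.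
  (* The last index, 2n, falls outside the range of sum_skip_even. *)
  rewrite [X in _ + X = _](f_even _ n) // addr0.
  rewrite (sum_skip_even (f := f (2 * n)%N)) // ?f0 ?muln_gt0 //; last exact: f_even.
  move/eqP; rewrite addr_eq0 => /eqP ->.
  rewrite -sumrN mulr_sumr; apply: eq_big_nat => i /andP[i_gt0 le_in].
  rewrite /f euler0_odd // altsumT //; last by lia.
  have -> : (2 * n - (2 * i - 1) = 2 * n - 2 * i + 1)%N by lia.
  ring.
have := euler0_altsum (2 * n - 1) hkodd.
have -> : (2 * n - 1).+1 = (2 * n)%N by lia.
rewrite (sum_skip_even (f := f (2 * n - 1)%N)) //; last exact: f_even.
rewrite f0; last by lia.
(* The top index j = 2n - 1 carries exponent 0, where altsum is 1 but T is 0. *)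
rewrite big_nat_recr //= {2}/f binn subnn altsum0 // euler0_odd //.
rewrite (eq_big_nat _ _ (F2 := fun i => 2 *
  ('C(2 * n - 1, 2 * i - 1)%:R * (bernoulli (2 * i) / (2 * i)%:R)
        * k%:R ^+ (2 * i - 1) * (1 - 2 ^+ (2 * i))
        * T (2 * n - 2 * i) k))).
  rewrite -mulr_sumr; set S := \sum_(_ <= _ < _) _; lra.
move=> i /andP[i_gt0 lt_in]; rewrite /f euler0_odd // altsumT //; last by lia.
have -> : (2 * n - 1 - (2 * i - 1) = 2 * n - 2 * i)%N by lia.
ring.
Qed.
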